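(* Let $G$ be a connected undirected graph with vertex set $\{1,\dots,n\}$, without loops or multiple edges, with weights $w_{ij}=w_{ji}$ in a commutative ring $\mathcal A$ assigned to its edges $\{i,j\}$, and with an arbitrary fixed numeration of its edges. Then the external activity polynomial $C_G(w)$ satisfies $$C_G(w)=\sum_{k=1}^n(-1)^{k-1}(k-1)!\sum_{\{1,\dots,n\}=P_1\sqcup\dots\sqcup P_k}\ \prod_{\substack{\{i,j\}\text{ edge of }G:\\ \exists s:\ i,j\in P_s}}(w_{ij}+1),$$ where the inner sum is over all (unordered) partitions of the vertex set into $k$ pairwise disjoint nonempty subsets, and the product is over all edges $\{i,j\}$ of $G$ both of whose endpoints belong to the same $P_s$ for some $s\in\{1,\dots,k\}$.
   Context: For a spanning tree $T$ of $G$ and an edge $e$ of $G$ not in $T$, the graph $T\cup e$ has exactly one cycle, and it contains $e$; the edge $e$ is called externally active for $T$ if $e$ is the smallest edge (with respect to the fixed numeration) in this cycle. Put $w(T)=\prod_{\{i,j\}\in T}w_{ij}$. The external activity polynomial is $$C_G(w)=\sum_{T\text{ spanning tree of }G}w(T)\prod_{\{i,j\}\text{ externally active for }T}(w_{ij}+1).$$ *)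

(* Defs.v *)
From HB Require Import structures.
From mathcomp Require Import all_boot all_order all_algebra.

Set Implicit Arguments.
Unset Strict Implicit.
Unset Printing Implicit Defensive.

Import GRing.Theory.

Local Open Scope ring_scope.

(* A loopless graph without multiple edges on the vertex set 'I_n (standing
   for {1, ..., n}) is given by its set E of edges, each edge {i, j} being the
   two-element vertex set [set i; j]. Weights are functions of the edge, so
   that w_ij = w_ji holds by construction. *)
Definition simple_edges (n : nat) (E : {set {set 'I_n}}) : bool :=
  [forall e in E, #|e| == 2%N].

Definition adj (n : nat) (F : {set {set 'I_n}}) : rel 'I_n :=
  fun i j => [set i; j] \in F.

(* All vertices of 'I_n must be linked, so for a subset of the edges this says
   that the corresponding subgraph is both spanning and connected. It holds
   vacuously for n = 0. *)
Definition connected_edges (n : nat) (F : {set {set 'I_n}}) : bool :=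
  [forall i, forall j, connect (adj F) i j].

Definition cycle_edges (n : nat) (p : seq 'I_n) : {set {set 'I_n}} :=
  [set [set x; next p x] | x in p].

(* C is the edge set of a cycle through at least 3 pairwise distinct vertices;
   the bound k <= n on its length is automatic. *)
Definition is_cycle (n : nat) (C : {set {set 'I_n}}) : bool :=
  [exists k : 'I_n.+1, exists p : k.-tuple 'I_n,
     [&& (2 < k)%N, uniq p & C == cycle_edges p]].

Definition acyclic_edges (n : nat) (F : {set {set 'I_n}}) : bool :=
  [forall C : {set {set 'I_n}}, (C \subset F) ==> ~~ is_cycle C].

Definition spanning_tree (n : nat) (E T : {set {set 'I_n}}) : bool :=
  [&& T \subset E, connected_edges T & acyclic_edges T].

(* A numeration of E lists its edges without repetition; the number of an edge
   is its position in the list. *)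
Definition numeration (n : nat) (E : {set {set 'I_n}})
    (s : seq {set 'I_n}) : bool :=
  perm_eq s (enum E).

(* For a spanning tree T and an edge e outside T there is exactly one cycle C
   in e |: T, so the existential below selects that cycle. *)
Definition ext_active (n : nat) (E : {set {set 'I_n}}) (s : seq {set 'I_n})
    (T : {set {set 'I_n}}) (e : {set 'I_n}) : bool :=
  [&& e \in E, e \notin T &
   [exists C : {set {set 'I_n}},
     [&& is_cycle C, C \subset e |: T, e \in C &
      [forall f in C, (index e s <= index f s)%N]]]].

Definition ext_activity_poly (A : comPzRingType) (n : nat)
    (E : {set {set 'I_n}}) (s : seq {set 'I_n}) (w : {set 'I_n} -> A) : A :=
  \sum_(T : {set {set 'I_n}} | spanning_tree E T)
    ((\prod_(e in T) w e) * \prod_(e | ext_active E s T e) (w e + 1)).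

(* Main.v *)
Require Import Defs.
From HB Require Import structures.
From mathcomp Require Import all_boot all_order all_algebra.

Set Implicit Arguments.
Unset Strict Implicit.
Unset Printing Implicit Defensive.

Import GRing.Theory.

Local Open Scope ring_scope.

(** Both sides equal the sum of w(H), the product of the weights of the edges
    in H, over all sets H of edges of G that connect all the vertices.

    On the left, expanding the product of the factors w_e + 1 over the
    externally active edges turns C_G(w) into a sum of w(H) over the pairs
    (T, H) where T is a spanning tree contained in H and every edge of H
    outside T is externally active for T. Each connected H occurs in exactly
    one such pair, because T has to be the tree that Kruskal's algorithm
    extracts from H when it examines the edges in decreasing order: an edge of
    H is kept unless its endpoints are already linked by larger edges of H
    ([activity_interval]). That argument only needs to know when an edge set
    links the endpoints of an edge ([spans]), a closure operator. Cycles are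
    translated into it once and for all by [cycle_minus_edge_spans] and
    [spans_cycle].

    On the right, expanding the products and exchanging the sums leaves, for
    each set F of edges, w(F) times the sum of (-1)^(k-1) (k-1)! over the
    partitions having k blocks and all edges of F inside blocks. This
    coefficient is 1 if F is connected, since only the one-block partition
    qualifies, and 0 otherwise ([sum_mobius_compat]). For the latter, let B be
    a connected component of F. A qualifying partition with k + 1 blocks, one
    of which is B, yields k qualifying partitions with k blocks when B is merged
    into one of the other blocks, and every qualifying partition in which B is
    not a block arises exactly once in this way ([sum_merge_component]). The contributions cancel since
    (-1)^k k! + k (-1)^(k-1) (k-1)! = 0. *)

(** * Cycles and connectivity *)

Lemma simple_edgesP (n : nat) (E : {set {set 'I_n}}) e :
  simple_edges E -> e \in E -> exists x y, x != y /\ e = [set x; y].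
Proof.
move=> /forall_inP sE eE; have /cards2P[x [y [xy ->]]] := sE e eE.
by exists x, y.
Qed.

Lemma simple_edgesS (n : nat) (F F' : {set {set 'I_n}}) :
  F \subset F' -> simple_edges F' -> simple_edges F.
Proof.
by move=> /subsetP FF' /forall_inP s; apply/forall_inP => e /FF'; apply: s.
Qed.

Lemma adj_sym (n : nat) (F : {set {set 'I_n}}) : symmetric (adj F).
Proof. by move=> x y; rewrite /adj setUC. Qed.

Lemma connect_adj_sym (n : nat) (F : {set {set 'I_n}}) : connect_sym (adj F).
Proof. exact/sym_connect_sym/adj_sym. Qed.

Lemma connect_adjS (n : nat) (F F' : {set {set 'I_n}}) :
  F \subset F' -> subrel (connect (adj F)) (connect (adj F')).
Proof.
by move=> /subsetP FF'; apply: connect_sub => x y /FF'; apply: connect1.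
Qed.

Lemma is_cycleP (n : nat) (C : {set {set 'I_n}}) :
  reflect (exists p, [/\ (2 < size p)%N, uniq p & C = cycle_edges p])
          (is_cycle C).
Proof.
apply: (iffP existsP) => [[k /existsP[p /and3P[k2 up /eqP ->]]]|].
  by exists p; rewrite size_tuple.
move=> [p [p2 up ->]]; have pn : (size p < n.+1)%N.
  by rewrite ltnS -{2}[n]card_ord -(card_uniqP up) max_card.
exists (Ordinal pn); apply/existsP; exists (in_tuple p).
by rewrite up p2 eqxx.
Qed.

(** For an edge e this is membership of e in the closure of F in the graphic
    matroid; quantifying over all vertices of e avoids naming its two ends. *)
Definition spans (n : nat) (F : {set {set 'I_n}}) (e : {set 'I_n}) : bool :=
  [forall i in e, forall j in e, connect (adj F) i j].

Lemma spansP (n : nat) (F : {set {set 'I_n}}) (e : {set 'I_n}) :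
  reflect {in e &, forall i j, connect (adj F) i j} (spans F e).
Proof.
apply: (iffP forall_inP) => [h i j ie je | h i ie].
  by have /forall_inP := h i ie; apply.
by apply/forall_inP => j je; apply: h.
Qed.

Lemma spans2 (n : nat) (F : {set {set 'I_n}}) (i j : 'I_n) :
  spans F [set i; j] = connect (adj F) i j.
Proof.
apply/spansP/idP => [|cij x y]; first by apply; rewrite !inE eqxx ?orbT.
by rewrite !inE => /orP[]/eqP-> /orP[]/eqP->; rewrite // connect_adj_sym.
Qed.

Lemma spans_subset (n : nat) (F F' : {set {set 'I_n}}) e :
  F \subset F' -> spans F e -> spans F' e.
Proof.
move=> FF' /spansP h; apply/spansP => i j ie je.
exact: (connect_adjS FF') (h i j ie je).
Qed.

Lemma connect_spans (n : nat) (F F' : {set {set 'I_n}}) :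
  {in F', forall f, spans F f} -> subrel (connect (adj F')) (connect (adj F)).
Proof. by move=> h; apply: connect_sub => x y /h; rewrite spans2. Qed.

Lemma spans_trans (n : nat) (F F' : {set {set 'I_n}}) e :
  {in F', forall f, spans F f} -> spans F' e -> spans F e.
Proof.
move=> h /spansP h'; apply/spansP => i j ie je.
exact: (connect_spans h) (h' i j ie je).
Qed.

Lemma mem_spans (n : nat) (F : {set {set 'I_n}}) e :
  simple_edges F -> e \in F -> spans F e.
Proof.
move=> sF eF; have [x [y [_ exy]]] := simple_edgesP sF eF.
by rewrite exy spans2 connect1 // /adj -exy.
Qed.

(** Cutting the cycle at e leaves a path between the ends of e. The length at
    least 3 ensures that no other step of the cycle runs along e. *)
Lemma cycle_minus_edge_spans (n : nat) (C : {set {set 'I_n}}) e :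
  is_cycle C -> e \in C -> spans (C :\ e) e.
Proof.
move=> /is_cycleP[p [p2 up ->]] /imsetP[x xp ->].
have [i q pq] := rot_to xp.
have uq : uniq (x :: q) by rewrite -pq rot_uniq.
have nE : next p =1 next (x :: q) by move=> z; rewrite -pq next_rot.
have sz : (2 < size (x :: q))%N by rewrite -pq size_rot.
have mE z : (z \in x :: q) = (z \in p) by rewrite -pq mem_rot.
case: q uq nE sz mE {pq} => [|y [|z q]] // uq nE _ mE.
have nx : next p x = y by rewrite nE /= eqxx.
rewrite nx spans2 connect_adj_sym.
have xq : x \notin y :: z :: q by case/andP: uq.
have cy : path (frel (next p)) y (rcons (z :: q) x).
  rewrite (eq_path (e' := frel (next [:: x, y, z & q]))); last first.
    by move=> a b /=; rewrite nE.
  by have := cycle_next uq; rewrite [cycle _ _]/= => /andP[_].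
rewrite rcons_path in cy; case/andP: cy => py /eqP lx.
set l := last y (z :: q) in lx.
have lq : l \in z :: q by rewrite /l /= mem_last.
have ly : l != y by apply: contraTneq lq => ->; case/and3P: uq.
have lx' : l != x.
  by apply: contraNneq xq => <-; rewrite inE lq orbT.
(* The path y, z, ..., l avoids x, so none of its edges is e = {x, y}; the
   closing edge {l, x} differs from e because l is not y. *)
apply: (connect_trans (y := l)).
  apply/connectP; exists (z :: q) => //.
  apply: (@sub_in_path _ [pred a | (a \in p) && (a != x)] _ _ _ _ _ _ py).
    move=> a b /andP[ap ax] /andP[bp bx] /= /eqP ab; rewrite /adj !inE -ab.
    apply/andP; split; last exact: imset_f.
    apply: contraNneq ax => eab; rewrite eq_sym.
    have: x \in [set a; next p a] by rewrite eab !inE eqxx.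
    by rewrite !inE ab [x == b]eq_sym (negPf bx) orbF.
  apply/allP => a ay; rewrite /= -mE inE ay orbT /=.
  by apply: contraNneq xq => <-.
apply: connect1; rewrite /adj !inE -lx; apply/andP; split; last first.
  by apply: imset_f; rewrite -mE in_cons in_cons lq !orbT.
rewrite lx; apply: contraNneq ly => exy.
have: l \in [set x; y] by rewrite -exy !inE eqxx.
by rewrite !inE (negPf lx').
Qed.

(** A repetition-free path from x to y in F is closed up by the edge {x, y};
    as {x, y} is not in F, the path has at least two edges and the cycle has
    length at least 3. *)
Lemma spans_cycle (n : nat) (F : {set {set 'I_n}}) (x y : 'I_n) :
  x != y -> [set x; y] \notin F -> connect (adj F) x y ->
  exists C, [/\ is_cycle C, C \subset [set x; y] |: F & [set x; y] \in C].
Proof.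
move=> xy eF /connectP[p0 pp ey].
case: (shortenP pp) (ey) => p {}pp up _ {}ey.
have p2 : (2 < size (x :: p))%N.
  case: p pp ey {up} => [_ /= ey|z [/=|//]]; first by rewrite ey eqxx in xy.
  by rewrite andbT /adj => h ey; rewrite ey h in eF.
have [_ ly] : path (frel (next (x :: p))) x p /\ next (x :: p) y = x.
  by have := cycle_next up; rewrite /cycle rcons_path -ey => /andP[-> /eqP ->].
have cp : cycle (adj ([set x; y] |: F)) (x :: p).
  rewrite /cycle rcons_path -ey; apply/andP; split.
    by apply: sub_path pp => a b; rewrite /adj !inE => ->; rewrite orbT.
  by rewrite /adj [[set y; x]]setUC setU11.
exists (cycle_edges (x :: p)); split.
- by apply/is_cycleP; exists (x :: p).
- by apply/subsetP => _ /imsetP[z zp ->]; apply: next_cycle cp zp.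
- by apply/imsetP; exists y; rewrite ?ly 1?setUC // ey mem_last.
Qed.

(** * The spanning tree that makes all other edges active *)

Definition above (n : nat) (r : {set 'I_n} -> nat) (F : {set {set 'I_n}})
  (e : {set 'I_n}) : {set {set 'I_n}} := [set f in F | (r e < r f)%N].

Lemma aboveS (n : nat) (r : {set 'I_n} -> nat) (F F' : {set {set 'I_n}}) e f :
  F \subset F' -> (r f <= r e)%N -> above r F e \subset above r F' f.
Proof.
move=> /subsetP FF' fe; apply/subsetP => g; rewrite !inE => /andP[/FF' -> /=].
exact: leq_ltn_trans.
Qed.

Lemma above_subset (n : nat) (r : {set 'I_n} -> nat) (F : {set {set 'I_n}}) e :
  above r F e \subset F.
Proof. by apply/subsetP => g; rewrite inE => /andP[]. Qed.

(** A cycle in which e is the smallest edge is e together with a path of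
    larger edges of T. *)
Lemma ext_activeE (n : nat) (E T : {set {set 'I_n}}) (s : seq {set 'I_n}) e :
  simple_edges E -> T \subset E -> {in E &, injective (index^~ s)} ->
  ext_active E s T e =
  [&& e \in E, e \notin T & spans (above (index^~ s) T e) e].
Proof.
move=> sE /subsetP TE injs; rewrite /ext_active.
case eE: (e \in E) => //=; case eT: (e \in T) => //=.
apply/existsP/idP => [[C /and4P[cC /subsetP CT eC /forall_inP minC]]|].
  apply: spans_subset (cycle_minus_edge_spans cC eC).
  apply/subsetP => f; rewrite !inE => /andP[fe fC].
  have := CT f fC; rewrite !inE (negPf fe) /= => fT.
  rewrite fT ltn_neqAle minC // andbT eq_sym.
  by apply: contraNneq fe => /(injs _ _ (TE _ fT) eE) ->.
have [x [y [xy exy]]] := simple_edgesP sE eE.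
have aT := subsetP (above_subset (index^~ s) T e).
rewrite {2}exy spans2 => /spans_cycle[] // => [|C []].
  by rewrite -exy; apply: contraFN eT => /aT.
rewrite -exy => cC /subsetP CT eC; exists C; rewrite cC eC /=.
apply/andP; split.
  by apply/subsetP => f /CT; rewrite !inE => /orP[-> //|/andP[->]]; rewrite orbT.
apply/forall_inP => f /CT; rewrite !inE => /orP[/eqP-> //|/andP[_]].
exact: ltnW.
Qed.

(** Kruskal's algorithm for a spanning tree of maximal rank: the condition
    refers to the larger edges of H itself, rather than to those kept so far,
    which makes the definition non-recursive; [greedy_tree_spans] shows that
    both sets span the same. *)
Definition greedy_tree (n : nat) (r : {set 'I_n} -> nat)
  (H : {set {set 'I_n}}) : {set {set 'I_n}} :=
  [set e in H | ~~ spans (above r H e) e].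

(** By induction from the largest rank downwards: the larger edges of H that
    link the ends of e are themselves kept or linked by larger kept edges. *)
Lemma greedy_tree_spans (n : nat) (r : {set 'I_n} -> nat)
    (H : {set {set 'I_n}}) e :
  simple_edges H -> e \in H -> e \notin greedy_tree r H ->
  spans (above r (greedy_tree r H) e) e.
Proof.
(* The induction measure is the distance from r e to the maximal rank. *)
move=> sH; have [m] := ubnP (\max_(f in H) r f - r e).
elim: m e => // m IH e; rewrite ltnS => le_m eH.
rewrite inE eH negbK /=; apply: spans_trans => f; rewrite inE => /andP[fH ef].
case fT: (f \in greedy_tree r H).
  apply: mem_spans; last by rewrite inE fT.
  by apply: simple_edgesS sH; apply/subsetP => g; rewrite !inE -!andbA => /andP[].
apply: spans_subset (aboveS (subxx _) (ltnW ef)) _.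
apply: IH => //; last by rewrite fT.
apply: leq_trans le_m; apply: ltn_sub2l => //; apply: leq_trans ef _.
exact: (@leq_bigmax_cond _ _ r).
Qed.

(** The smallest edge of a cycle is linked by the rest of the cycle, which
    consists of larger edges, so it was not kept. *)
Lemma greedy_tree_acyclic (n : nat) (r : {set 'I_n} -> nat)
    (H : {set {set 'I_n}}) :
  {in H &, injective r} -> acyclic_edges (greedy_tree r H).
Proof.
move=> injr; apply/forall_inP => C /subsetP CT; apply/negP => cC.
have [e0 e0C] : exists e, e \in C.
  have /is_cycleP[[|x p] [// _ _ ->]] := cC.
  by exists [set x; next (x :: p) x]; apply: imset_f; rewrite inE eqxx.
have [e eC min_e] := arg_minnP r e0C.
have := CT e eC; rewrite inE => /andP[eH /negP[]].
apply: spans_subset (cycle_minus_edge_spans cC eC).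
apply/subsetP => f; rewrite !inE => /andP[fe fC].
have := CT f fC; rewrite inE => /andP[fH _].
rewrite fH ltn_neqAle min_e // andbT eq_sym.
by apply: contraNneq fe => /injr->.
Qed.

Lemma acyclic_not_spans (n : nat) (T F : {set {set 'I_n}}) e :
  simple_edges T -> acyclic_edges T -> e \in T -> F \subset T :\ e ->
  ~~ spans F e.
Proof.
move=> sT aT eT FT; have [x [y [xy exy]]] := simple_edgesP sT eT.
apply/negP => /(spans_subset FT); rewrite {2}exy spans2.
case/spans_cycle => // [|C [cC]]; first by rewrite -exy !inE eqxx.
by rewrite -exy setD1K // => CT _; have /forall_inP/(_ C CT)/negP[] := aT.
Qed.

(** For fixed T the sets H on the left form the interval from T to T together
    with its active edges. These intervals partition the connected edge sets,
    [greedy_tree] being the map that sends H to the T of its interval. If T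
    has the left-hand properties and e is in T, then whatever the edges of H
    above e link is already linked by edges of T above e, so linking the ends
    of e would close a cycle in T. *)
Lemma activity_interval (n : nat) (E H T : {set {set 'I_n}}) s :
  simple_edges E -> {in E &, injective (index^~ s)} ->
  H \subset E ->
  (spanning_tree E T &&
   [&& T \subset H & H :\: T \subset [set e | ext_active E s T e]]) =
  connected_edges H && (T == greedy_tree (index^~ s) H).
Proof.
move=> sE injs HE; have sH := simple_edgesS HE sE.
have injH : {in H &, injective (index^~ s)}.
  by move=> x y xH yH; apply: injs; apply: (subsetP HE).
apply/andP/andP => [[/and3P[TE cT aT] /andP[TH /subsetP HT]]|[cH /eqP ->]].
  have sT := simple_edgesS TE sE; split.
    apply/forallP => i; apply/forallP => j; apply: (connect_adjS TH).
    by have /forallP/(_ i)/forallP/(_ j) := cT.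
  have actT e : e \in H -> e \notin T -> spans (above (index^~ s) T e) e.
    move=> eH eT; have := HT e; rewrite inE eT eH => /(_ isT).
    by rewrite inE ext_activeE // => /and3P[].
  apply/eqP/setP => e; rewrite inE; case eH: (e \in H); last first.
    by apply: contraFF eH => /(subsetP TH).
  apply/idP/idP => [eT|]; last first.
    apply: contraR => eT; apply: spans_subset (actT e eH eT).
    exact: aboveS.
  apply/negP => spe.
  (* Contradiction with acyclicity of T, once the larger edges of H have been
     replaced by the larger edges of T that span them. *)
  have: spans (above (index^~ s) T e) e; last first.
    apply/negP; apply: acyclic_not_spans aT eT _ => //.
    apply/subsetP => f; rewrite !inE => /andP[-> ef]; rewrite andbT.
    by apply: contraTneq ef => ->; rewrite ltnn.
  apply: spans_trans spe => f; rewrite inE => /andP[fH ef].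
  case fT: (f \in T).
    apply: mem_spans; last by rewrite inE fT.
    exact: simple_edgesS (above_subset _ _ _) sT.
  apply: spans_subset (aboveS (subxx _) (ltnW ef)) _.
  by apply: actT; rewrite // fT.
set T' := greedy_tree _ H.
have TH : T' \subset H by apply/subsetP => f; rewrite inE => /andP[].
have TE := subset_trans TH HE.
split; last first.
  rewrite TH; apply/subsetP => e; rewrite inE => /andP[eT eH].
  rewrite inE ext_activeE // (subsetP HE) // eT.
  exact: greedy_tree_spans.
rewrite /spanning_tree TE greedy_tree_acyclic // andbT /=.
apply/forallP => i; apply/forallP => j.
have /forallP/(_ i)/forallP/(_ j) := cH; apply: connect_spans => f fH.
case fT: (f \in T').
  by apply: mem_spans => //; apply: simple_edgesS sE.
apply: spans_subset (above_subset (index^~ s) _ f) _.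
by apply: greedy_tree_spans; rewrite ?fT.
Qed.

(** * Partitions whose blocks contain a given set of edges *)

Definition compat (n : nat) (F P : {set {set 'I_n}}) : bool :=
  [forall e in F, exists B in P, e \subset B].

Lemma compatP (n : nat) (F P : {set {set 'I_n}}) :
  reflect {in F, forall e : {set _}, exists2 B, B \in P & e \subset B}
          (compat F P).
Proof.
apply: (iffP forall_inP) => h e eF; first by have /exists_inP := h e eF.
by apply/exists_inP; apply: h.
Qed.

(** Each edge of F lies in one block, so a path in F never leaves its block. *)
Lemma compat_connect_pblock (n : nat) (F P : {set {set 'I_n}}) (i j : 'I_n) :
  trivIset P -> compat F P -> connect (adj F) i j -> pblock P i = pblock P j.
Proof.
move=> tP /compatP cP /connectP[p pp ->].
elim: p i pp => //= k p IH i /andP[ik /IH <-].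
have [B BP /subsetP ikB] := cP _ ik.
by rewrite !(def_pblock (B := B)) // ikB // !inE eqxx ?orbT.
Qed.

Definition component (n : nat) (F : {set {set 'I_n}}) (v : 'I_n) : {set 'I_n} :=
  [set u | connect (adj F) v u].

Lemma mem_component (n : nat) (F : {set {set 'I_n}}) (v : 'I_n) :
  v \in component F v.
Proof. by rewrite inE. Qed.

Lemma component_closed (n : nat) (F : {set {set 'I_n}}) (v : 'I_n) e :
  simple_edges F -> e \in F ->
  (e \subset component F v) || [disjoint e & component F v].
Proof.
move=> sF eF; case: (boolP [disjoint _ & _]) => [|]; first by rewrite orbT.
rewrite -setI_eq0 => /set0Pn[x]; rewrite !inE => /andP[xe vx]; rewrite orbF.
apply/subsetP => y ye; rewrite inE; apply: connect_trans vx _.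
by have /spansP := mem_spans sF eF; apply.
Qed.

(** Serves to show that a block built by merging or splitting is new, which
    makes the constructions invertible and fixes the number of blocks. *)
Lemma partition_notin (T : finType) (Q : {set {set T}}) (D Z : {set T}) :
  partition Q D -> Z != set0 -> [disjoint Z & D] -> Z \notin Q.
Proof.
move=> pQ Z0 ZD; apply: contra Z0 => /(partitionS pQ) /setIidPl ZDE.
by rewrite -ZDE setI_eq0.
Qed.

(** The argument is the pair of a partition and one of its blocks, so that
    this is literally the inverse of [split_block]. *)
Definition merge_block (T : finType) (B : {set T}) (PX : {set {set T}} * {set T})
  : {set {set T}} := (PX.2 :|: B) |: (PX.1 :\ B :\ PX.2).

(** The second component records the rest of the block that B was cut from. *)
Definition split_block (T : finType) (v : T) (B : {set T}) (P : {set {set T}})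
  : {set {set T}} * {set T} :=
  let Y := pblock P v in (B |: ((Y :\: B) |: (P :\ Y)), Y :\: B).

Lemma merge_blockP (T : finType) (v : T) (B : {set T}) (P : {set {set T}})
    (X : {set T}) :
  partition P setT -> v \in B -> B \in P -> X \in P :\ B ->
  [/\ partition (merge_block B (P, X)) setT, B \notin merge_block B (P, X),
      #|merge_block B (P, X)| = #|P|.-1 &
      split_block v B (merge_block B (P, X)) = (P, X)].
Proof.
move=> pP vB BP XP; rewrite /split_block /merge_block /=.
have pPB := partitionD1 pP BP; have pQ := partitionD1 pPB XP.
have X0 := partition_neq0 pPB XP.
have dXB : [disjoint X & B].
  have := partitionS pPB XP; rewrite subsetD => /andP[_ //].
set Q := P :\ B :\ X in pQ *; set D := _ :\: X in pQ.
have UD : X :|: B :|: D = setT.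
  by apply/setP => x; rewrite !inE; do !case: (x \in _).
have dUD : [disjoint X :|: B & D].
  rewrite -setI_eq0; apply/eqP/setP => x; rewrite !inE.
  by do !case: (x \in _).
have U0 : X :|: B != set0 by rewrite setU_eq0 negb_and X0.
have pM : partition ((X :|: B) |: Q) setT by rewrite -UD partitionU1.
have UQ : X :|: B \notin Q := partition_notin pQ U0 dUD.
have eP : B |: (X |: Q) = P by rewrite /Q !setD1K.
have XB : X != B by move: XP; rewrite !inE => /andP[].
split=> //.
- rewrite !inE eqxx !andbF orbF.
  apply: contra X0 => /eqP BU; rewrite -(setIidPl (_ : X \subset B)).
    by rewrite setI_eq0.
  by rewrite BU subsetUl.
- rewrite cardsU1 UQ -eP cardsU1 cardsU1 !inE !eqxx /= !add1n andbF orbF.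
  by rewrite eq_sym XB.
have -> : pblock ((X :|: B) |: Q) v = X :|: B.
  apply: def_pblock; rewrite ?setU11 ?(partition_trivIset pM) //.
  by rewrite inE vB orbT.
by rewrite setDUl setDv setU0 (setDidPl dXB) setU1K // eP.
Qed.

Lemma split_blockP (T : finType) (v : T) (B : {set T}) (P : {set {set T}}) :
  partition P setT -> v \in B -> B \notin P -> B \subset pblock P v ->
  let PX := split_block v B P in
  [/\ partition PX.1 setT, B \in PX.1, PX.2 \in PX.1 :\ B &
      merge_block B PX = P].
Proof.
move=> pP vB nBP BY; rewrite /split_block /merge_block /=.
set Y := pblock P v in BY *.
have YP : Y \in P by apply: pblock_mem; rewrite (cover_partition pP) inE.
have B0 : B != set0 by apply/set0Pn; exists v.
have YB0 : Y :\: B != set0.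
  by rewrite setD_eq0; apply: contra nBP => YB; rewrite (_ : B = Y) //;
     apply/eqP; rewrite eqEsubset BY.
have pQ := partitionD1 pP YP.
set Q := P :\ Y in pQ *.
have dYB : [disjoint Y :\: B & setT :\: Y].
  rewrite -setI_eq0; apply/eqP/setP => x; rewrite !inE.
  by do !case: (x \in _).
have pQ1 := partitionU1 pQ YB0 dYB.
have dB : [disjoint B & (Y :\: B) :|: (setT :\: Y)].
  rewrite -setI_eq0; apply/eqP/setP => x; rewrite !inE.
  by case xB: (x \in B); rewrite // (subsetP BY).
have pQ2 := partitionU1 pQ1 B0 dB.
have DT : B :|: ((Y :\: B) :|: (setT :\: Y)) = setT.
  by apply/setP => x; rewrite !inE; do !case: (x \in _).
rewrite DT in pQ2; split=> //; first by rewrite setU11.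
  rewrite !inE eqxx orbT andbT.
  apply: contraNneq YB0 => e; move: dB.
  by rewrite -{1}e -setI_eq0 setIUr setIid setU_eq0 => /andP[].
rewrite setU1K; last exact: partition_notin pQ1 B0 dB.
rewrite setU1K; last exact: partition_notin pQ YB0 dYB.
by rewrite [_ :|: B]setUC -{1}(setIidPr BY) setID setD1K.
Qed.

(** Merging B into X and splitting B off again are inverse bijections. They
    preserve the condition on F because every edge of F is either inside the
    component B or disjoint from it, and splitting is possible because B,
    being connected, lies within one block. *)
Lemma sum_merge_component (A : zmodType) (n : nat) (F : {set {set 'I_n}})
    (v : 'I_n) (g : nat -> A) :
  simple_edges F -> let B := component F v in
  \sum_(P | (partition P setT && compat F P) && (B \in P))
     \sum_(X in P :\ B) g #|P|.-1 =
  \sum_(P | (partition P setT && compat F P) && (B \notin P)) g #|P|.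
Proof.
move=> sF B; have vB : v \in B := mem_component F v.
have closedB e : e \in F -> (e \subset B) || [disjoint e & B].
  exact: component_closed.
have splitP P : (partition P setT && compat F P) && (B \notin P) ->
  let PX := split_block v B P in
  [/\ partition PX.1 setT, compat F PX.1, B \in PX.1, PX.2 \in PX.1 :\ B &
      merge_block B PX = P].
  case/andP=> /andP[pP cP] nBP; have tP := partition_trivIset pP.
  have BY : B \subset pblock P v.
    apply/subsetP => x; rewrite inE => /(compat_connect_pblock tP cP) ->.
    by rewrite mem_pblock (cover_partition pP) inE.
  have [h1 h2 h3 h4] := split_blockP pP vB nBP BY.
  split=> //; apply/compatP => e eF; rewrite /split_block /=.
  have [eB|] := orP (closedB e eF); first by exists B; rewrite ?setU11.
  move=> eB; have /compatP/(_ e eF)[Z ZP eZ] := cP.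
  have [eY|ZY] := eqVneq Z (pblock P v).
    exists (pblock P v :\: B); first by rewrite !inE eqxx orbT.
    by rewrite subsetD -eY eZ.
  by exists Z; rewrite // !inE ZY ZP !orbT.
rewrite pair_big_dep [RHS](reindex_onto (merge_block B) (split_block v B)) /=.
  apply: esym; apply: eq_big => [[P X]|[P X]].
    rewrite /=; apply/andP/andP => [[Q /eqP eQ]|[/andP[/andP[pP cP] BP] XP]].
      by have [] := splitP _ Q; rewrite eQ /= => -> -> ->.
    have [h1 h2 h3 ->] := merge_blockP pP vB BP XP.
    rewrite h1 h2 eqxx andbT; split=> //; apply/compatP => e eF.
    have /compatP/(_ e eF)[Z ZP eZ] := cP.
    have [eB|ZB] := eqVneq Z B.
      by exists (X :|: B); rewrite ?setU11 // -eB (subset_trans eZ) ?subsetUr.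
    have [eX|ZX] := eqVneq Z X.
      by exists (X :|: B); rewrite ?setU11 // -eX (subset_trans eZ) ?subsetUl.
    by exists Z; rewrite // !inE ZX ZB ZP orbT.
  move=> /andP[Q /eqP eQ]; have [h1 h2 h3 h4 _] := splitP _ Q.
  rewrite eQ /= in h1 h2 h3 h4.
  by have [_ _ -> _] := merge_blockP h1 vB h3 h4.
by move=> P /splitP[].
Qed.

(** The Moebius function of the partition lattice, summed over the partitions
    coarser than the one into the components of F. *)
Lemma sum_mobius_compat (A : comPzRingType) (n : nat) (F : {set {set 'I_n}}) :
  (0 < n)%N -> simple_edges F ->
  \sum_(P : {set {set 'I_n}} | partition P setT && compat F P)
     (-1) ^+ (#|P| - 1) * ((#|P| - 1)`!)%:R = (connected_edges F)%:R :> A.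
Proof.
move=> n0 sF; pose v := Ordinal n0; set B := component F v.
have vB : v \in B := mem_component F v.
have BE : (B == setT) = connected_edges F.
  apply/eqP/forallP => [BT i|cF].
    apply/forallP => j; apply: (connect_trans (y := v)).
      by have := in_setT i; rewrite -BT inE connect_adj_sym.
    by have := in_setT j; rewrite -BT inE.
  apply/setP => j; rewrite !inE.
  by have /forallP/(_ j) := cF v.
rewrite -BE; case: eqP => [BT|/eqP BT].
  rewrite (big_pred1 [set setT]) => [|P].
    by rewrite cards1 /= expr0 fact0 mulr1.
  rewrite /=; apply/andP/eqP => [[pP cP]|->].
    have tP := partition_trivIset pP.
    have YT : pblock P v = setT.
      apply/setP => j; rewrite [RHS]inE.
      have: j \in B by rewrite BT inE.
      rewrite inE => /(compat_connect_pblock tP cP) ->.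
      by rewrite mem_pblock (cover_partition pP) inE.
    have TP : setT \in P.
      by rewrite -YT; apply: pblock_mem; rewrite (cover_partition pP) inE.
    apply/setP => Z; rewrite !inE; apply/idP/eqP => [ZP|-> //].
    have /set0Pn[x xZ] := partition_neq0 pP ZP.
    by rewrite -(def_pblock tP ZP xZ) (def_pblock tP TP) ?inE.
  split; last by apply/compatP => e _; exists setT; rewrite ?inE ?subsetT.
  rewrite /partition /cover big_set1 eqxx /trivIset /cover !big_set1 eqxx /=.
  by rewrite inE eq_sym; apply/set0Pn; exists v; rewrite inE.
(* The partitions having B as a block cancel against those obtained from them
   by merging B into one of the other blocks. *)
rewrite (bigID (fun P : {set {set 'I_n}} => B \in P)) /=.
pose mu k : A := (-1) ^+ (k - 1) * ((k - 1)`!)%:R.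
rewrite -(sum_merge_component v mu sF) -/B -big_split /=.
rewrite big1 // => P /andP[/andP[pP _] BP].
rewrite sumr_const; set k := #|P :\ B|.
have Pk : #|P| = k.+1 by rewrite (cardsD1 B) BP.
(* Otherwise B would be the whole vertex set, that is, F would be connected. *)
have k0 : (0 < k)%N.
  rewrite lt0n cards_eq0; apply: contra BT => /eqP PB0.
  have := partitionD1 pP BP; rewrite PB0 => /cover_partition.
  by rewrite /cover big_set0 => /esym/eqP; rewrite setD_eq0 -subTset.
rewrite Pk /mu; case: k k0 {Pk} => // k _.
rewrite /= !subn1 /= factS exprS mulN1r mulNr -mulrnAr natrM.
by rewrite -[(k`!)%:R *+ _]mulr_natl addNr.
Qed.

(** * Expanding both sides *)

(** Expansion of the product, written with the summand w_e set to 0 outside D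
    so that the subsets of I that are not contained in D contribute nothing. *)
Lemma prod_weight_succ (A : comPzRingType) (I : finType) (w : I -> A)
    (D : {set I}) :
  \prod_(e in D) (w e + 1) = \sum_(S : {set I} | S \subset D) \prod_(e in S) w e.
Proof.
rewrite big_mkcond /=.
pose F i := if i \in D then w i else 0; pose G (i : I) : A := 1.
rewrite (eq_bigr (fun i => F i + G i)); last first.
  by move=> i _; rewrite /F /G; case: ifP; rewrite ?add0r.
rewrite bigA_distr [RHS]big_mkcond /=; apply: eq_bigr => S _.
case: ifP => [SD|/negbT/subsetPn[x xS xD]].
  rewrite [RHS]big_mkcond; apply: eq_bigr => i _; rewrite /F.
  by case: ifP => // /(subsetP SD) ->.
by rewrite (bigD1 x) //= xS /F (negPf xD) mul0r.
Qed.

(** The pairs of a tree T and a set S of active edges are re-indexed by the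
    pairs of T and H, the union of T and S; then H determines T. *)
Lemma ext_activity_connected (A : comPzRingType) (n : nat)
    (E : {set {set 'I_n}}) (s : seq {set 'I_n}) (w : {set 'I_n} -> A) :
  simple_edges E -> {in E &, injective (index^~ s)} ->
  ext_activity_poly E s w =
  \sum_(H : {set {set 'I_n}} | (H \subset E) && connected_edges H)
     \prod_(e in H) w e.
Proof.
move=> sE injs; rewrite /ext_activity_poly.
pose Act T := [set e | ext_active E s T e].
have ActE T : Act T \subset E :\: T.
  by apply/subsetP => e; rewrite !inE => /and3P[-> ->].
transitivity (\sum_(T | spanning_tree E T)
   \sum_(H : {set {set 'I_n}} |
       (H \subset E) && ((T \subset H) && (H :\: T \subset Act T)))
     \prod_(e in H) w e).
  apply: eq_bigr => T /and3P[TE _ _].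
  rewrite (eq_bigl (mem (Act T))) => [|e]; last by rewrite /= !inE.
  rewrite prod_weight_succ big_distrr /=.
  rewrite [RHS](reindex_onto (fun S => T :|: S) (fun H => H :\: T)) /=;
    last by move=> H /and3P[_ /setIidPr TH _]; rewrite -{1}TH setID.
  apply: eq_big => [S|S SA].
    rewrite setDUl setDv set0U subUset TE subsetUl -andbA /=.
    apply/idP/and3P => [SA|[_ SA /eqP <- //]].
    have /subsetDP[SE ST] := subset_trans SA (ActE T).
    by rewrite (setDidPl ST) SE eqxx.
  have /subsetDP[SE ST] := subset_trans SA (ActE T).
  rewrite (bigID (mem T) (fun e => e \in T :|: S)) /=.
  congr (_ * _); apply: eq_bigl => e; rewrite !inE.
    by case: (e \in T); rewrite ?andbF.
  by case eS: (e \in S); rewrite ?orbT ?orbF ?andbN //= (disjointFr ST).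
rewrite (exchange_big_dep (fun H : {set {set 'I_n}} => H \subset E)) /=;
  last by move=> T H _ /andP[].
rewrite [RHS]big_mkcondr; apply: eq_bigr => H HE.
rewrite (eq_bigl (fun T : {set {set 'I_n}}
    => connected_edges H && (T == greedy_tree (index^~ s) H))).
  by case: ifP => _; rewrite ?big_pred0_eq // big_pred1_eq.
by move=> T; rewrite HE /= activity_interval.
Qed.

Lemma card_partition_bounds (T : finType) (P : {set {set T}}) :
  (0 < #|T|)%N -> partition P setT -> (1 <= #|P| < #|T|.+1)%N.
Proof.
move=> T0 pP; apply/andP; split.
  rewrite lt0n cards_eq0; apply: contraTN T0 => /eqP P0.
  have := cover_partition pP.
  by rewrite P0 /cover big_set0 -cardsT => <-; rewrite cards0.
rewrite ltnS -cardsT (card_partition pP) -sum1_card; apply: leq_sum => B BP.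
by rewrite card_gt0 (partition_neq0 pP).
Qed.

(** The sum over k only groups the partitions by number of blocks; once it is
    removed, exchanging the sums over P and F isolates the coefficient of w(F). *)
Lemma partition_sum_connected (A : comPzRingType) (n : nat)
    (E : {set {set 'I_n}}) (w : {set 'I_n} -> A) :
  (0 < n)%N -> simple_edges E ->
  \sum_(1 <= k < n.+1)
    (-1) ^+ (k - 1) * ((k - 1)`!)%:R *
    \sum_(P : {set {set 'I_n}} | partition P [set: 'I_n] && (#|P| == k))
      \prod_(e in E | [exists B in P, e \subset B]) (w e + 1) =
  \sum_(F : {set {set 'I_n}} | (F \subset E) && connected_edges F)
     \prod_(e in F) w e.
Proof.
move=> n0 sE.
pose mu k : A := (-1) ^+ (k - 1) * ((k - 1)`!)%:R.
pose G (P : {set {set 'I_n}}) :=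
  \prod_(e in E | [exists B in P, e \subset B]) (w e + 1).
transitivity (\sum_(P : {set {set 'I_n}} | partition P setT) mu #|P| * G P).
  rewrite (eq_bigr (fun k =>
    \sum_(P : {set {set 'I_n}} | partition P setT && (#|P| == k)) mu k * G P)).
    rewrite (exchange_big_dep (fun P : {set {set 'I_n}} => partition P setT)) /=;
      last by move=> k P _ /andP[].
    apply: eq_bigr => P pP.
    rewrite (eq_bigl (fun k => k == #|P|)) => [|k].
      have := card_partition_bounds _ pP; rewrite card_ord big_nat1_eq.
      by move=> ->.
    by rewrite pP eq_sym.
  by move=> k _; rewrite big_distrr.
transitivity (\sum_(P : {set {set 'I_n}} | partition P setT)
   \sum_(F : {set {set 'I_n}} | (F \subset E) && compat F P)
      mu #|P| * \prod_(e in F) w e).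
  apply: eq_bigr => P _; rewrite -big_distrr /=; congr (_ * _).
  rewrite /G (eq_bigl (mem [set e in E | [exists B in P, e \subset B]])).
    rewrite prod_weight_succ; apply: eq_bigl => F.
    apply/subsetP/andP => [h|[/subsetP FE /forall_inP cP] e eF].
      split; first by apply/subsetP => e /h; rewrite inE => /andP[].
      by apply/forall_inP => e /h; rewrite inE => /andP[].
    by rewrite inE FE ?cP.
  by move=> e; rewrite /= inE.
rewrite (exchange_big_dep (fun F : {set {set 'I_n}} => F \subset E)) /=;
  last by move=> P F _ /andP[].
rewrite [RHS]big_mkcondr; apply: eq_bigr => F FE.
rewrite FE /= -big_distrl /= sum_mobius_compat //; last exact: simple_edgesS sE.
by case: ifP => _; rewrite ?mul1r ?mul0r.
Qed.

Theorem theorem9 (A : comPzRingType) (n : nat) (n_gt0 : (0 < n)%N)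
    (E : {set {set 'I_n}}) (E_simple : simple_edges E)
    (E_connected : connected_edges E)
    (s : seq {set 'I_n}) (s_num : numeration E s)
    (w : {set 'I_n} -> A) :
  ext_activity_poly E s w =
  \sum_(1 <= k < n.+1)
    (-1) ^+ (k - 1) * ((k - 1)`!)%:R *
    \sum_(P : {set {set 'I_n}} | partition P [set: 'I_n] && (#|P| == k))
      \prod_(e in E | [exists B in P, e \subset B]) (w e + 1).
Proof.
rewrite partition_sum_connected //; apply: ext_activity_connected => //.
have mem_s : {in E, forall e, e \in s}.
  by move=> e eE; rewrite (perm_mem s_num) mem_enum.
by move=> e f /mem_s es /mem_s fs ief; rewrite -(nth_index e es) ief nth_index.
Qed.
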